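(* Consider any self-starting single-solve time integration algorithm of the 11-parameter family (described in the context), with fixed real parameters $p,\alpha_1,\dots,\alpha_{10}$, which is fully explicit, i.e. $\alpha_2=\alpha_4=0$. Then, when $\xi\neq 0$, the algorithm achieves at most identical second-order accuracy. That is, for physical damping ratio $\xi\in(0,1)$ and $\omega\in(0,\infty)$, there is no choice of real parameters $p,\alpha_1,\alpha_3,\alpha_5,\dots,\alpha_{10}$ (with $\alpha_2=\alpha_4=0$) and no integer $r\ge 3$ such that the algorithm achieves identical $r$-th-order accuracy for the equation $\ddot u+2\xi\omega\dot u+\omega^2u=f(t)$.
   Context: **Algorithm family.** For $M\ddot u=f(u,\dot u,t)$, a self-starting single-solve algorithm with real parameters $p,\alpha_1,\dots,\alpha_{10}$ and time step $\Delta t>0$ advances $(u_n,\dot u_n,\ddot u_n)$ at $t_n$ to $(u_{n+1},\dot u_{n+1},\ddot u_{n+1})$ at $t_{n+1}=t_n+\Delta t$ as follows. First, $\ddot u_{n+p}$ is determined by $$M\ddot u_{n+p}=f(u_{n+p},\dot u_{n+p},t_n+p\Delta t),$$ $$u_{n+p}=u_n+p\Delta t\,\dot u_n+\Delta t^2(\alpha_1\ddot u_n+\alpha_2\ddot u_{n+p}),\qquad \dot u_{n+p}=\dot u_n+\Delta t(\alpha_3\ddot u_n+\alpha_4\ddot u_{n+p}).$$ Then $$u_{n+1}=u_n+\Delta t\,\dot u_n+\Delta t^2(\alpha_5\ddot u_n+\alpha_6\ddot u_{n+p}),\quad \dot u_{n+1}=\dot u_n+\Delta t(\alpha_7\ddot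 u_n+\alpha_8\ddot u_{n+p}),\quad \ddot u_{n+1}=\alpha_9\ddot u_n+\alpha_{10}\ddot u_{n+p}.$$ The algorithm is *fully explicit* if $\alpha_2=\alpha_4=0$. **Test equation.** Accuracy is measured on the scalar equation $\ddot u(t)+2\xi\omega\dot u(t)+\omega^2u(t)=f(t)$ with $\xi\in[0,1)$, $\omega\in(0,\infty)$ and $f\in C^\infty(\mathbb R)$ (so $M=1$ and the force is $f(t)-2\xi\omega\dot u-\omega^2u$). For this equation the algorithm takes the form $$X_{n+1}=D_{\rm num}X_n+L_{\rm num}(t_n),\qquad X_n=(u_n,\dot u_n,\ddot u_n)^{\mathsf T}.$$ Explicitly, with $D=1+2\alpha_4\xi\omega\Delta t+\alpha_2\omega^2\Delta t^2$ (nonzero for small $\Delta t$), $$\ddot u_{n+p}=\tfrac1D\big[f(t_n+p\Delta t)-2\xi\omega(\dot u_n+\alpha_3\Delta t\,\ddot u_n)-\omega^2(u_n+p\Delta t\,\dot u_n+\alpha_1\Delta t^2\ddot u_n)\big]$$ is inserted in the update formulas. The $3\times3$ matrix $D_{\rm num}$ collects the dependence on $X_n$, and $L_{\rm num}(t_n)=\frac{f(t_n+p\Delta t)}{D}(\alpha_6\Delta t^2,\ \alpha_8\Delta t,\ \alpha_{10})^{\mathsf T}$. **Order of accuracy.** Let $\det(\lambda I_3-D_{\rm num})=\sum_{j=0}^3A_j\lambda^j$ (so $A_3=1$; the $A_j$ depend on $\Delta t$). For an exact solution $u$ of the test equation put $X(t)=(u(t),\dot u(t),\ddot u(t))^{\mathsf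 T}$ and $t_{n+i}=t_n+i\Delta t$. The local truncation error vector is $$\tau=(\tau_u,\tau_{\dot u},\tau_{\ddot u})^{\mathsf T}=\frac1{\Delta t^2}\Big(\sum_{i=0}^3A_iX(t_{n+i})-\sum_{i=0}^3A_i\sum_{j=0}^{i-1}D_{\rm num}^{\,j}L_{\rm num}(t_{n-j+i-1})\Big).$$ The algorithm is $r$-th-order accurate in displacement (resp. velocity, acceleration) if $\tau_u=\mathcal O(\Delta t^r)$ (resp. $\tau_{\dot u}$, $\tau_{\ddot u}$) as $\Delta t\to0$, for every $f\in C^\infty(\mathbb R)$, every exact solution $u$ and every $t_n$, with $\omega,\xi$ and the parameters fixed. It has *identical $r$-th-order accuracy* if all three components of $\tau$ are $\mathcal O(\Delta t^r)$ in this sense. *)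

(* Defs.v *)
From HB Require Import structures.
From mathcomp Require Import all_boot all_order all_algebra.
From mathcomp Require Import ring.
From mathcomp Require Import all_classical all_reals all_analysis.

Set Implicit Arguments.
Unset Strict Implicit.
Unset Printing Implicit Defensive.

Import Order.TTheory GRing.Theory Num.Theory.
Import numFieldNormedType.Exports.
Local Open Scope classical_set_scope.
Local Open Scope ring_scope.

Record scheme (R : Type) := Scheme {
  pp : R;
  al1 : R; al2 : R; al3 : R; al4 : R; al5 : R;
  al6 : R; al7 : R; al8 : R; al9 : R; al10 : R
}.

Definition fully_explicit (R : realType) (P : scheme R) : Prop :=
  al2 P = 0 /\ al4 P = 0.

(* One step of the scheme for M u'' = f(u, u', t), from (u0, v0, a0) at time t
   to (u1, v1, a1) at time t + h, as a relation. *)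
Definition scheme_step (R : realType) (V : lmodType R) (P : scheme R)
    (M : V -> V) (f : V -> V -> R -> V) (h t : R)
    (u0 v0 a0 u1 v1 a1 : V) : Prop :=
  exists ap : V,
    [/\ M ap = f (u0 + (pp P * h) *: v0 + h ^+ 2 *: (al1 P *: a0 + al2 P *: ap))
                 (v0 + h *: (al3 P *: a0 + al4 P *: ap))
                 (t + pp P * h),
        u1 = u0 + h *: v0 + h ^+ 2 *: (al5 P *: a0 + al6 P *: ap),
        v1 = v0 + h *: (al7 P *: a0 + al8 P *: ap)
      & a1 = al9 P *: a0 + al10 P *: ap].

(* The matrix form X_{n+1} = Dnum X_n + Lnum(t_n) for the test equation
   u'' + 2 xi om u' + om^2 u = f(t). *)
Section MatrixForm.
Variables (R : realType) (P : scheme R) (xi om : R).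

Definition col3 (x y z : R) : 'cV[R]_3 := \col_i [:: x; y; z]`_i.

Definition denom (h : R) : R :=
  1 + 2 * al4 P * xi * om * h + al2 P * om ^+ 2 * h ^+ 2.

(* The right-hand side of the formula for the acceleration at t + p h, where
   fp is the value of f at that time. *)
Definition acc_p (h fp : R) (X : 'cV[R]_3) : R :=
  let u := X 0 0 in let v := X 1 0 in let a := X 2%:R 0 in
  (fp - 2 * xi * om * (v + al3 P * h * a)
      - om ^+ 2 * (u + pp P * h * v + al1 P * h ^+ 2 * a)) / denom h.

Definition update (h fp : R) (X : 'cV[R]_3) : 'cV[R]_3 :=
  let u := X 0 0 in let v := X 1 0 in let a := X 2%:R 0 in
  let ap := acc_p h fp X in
  col3 (u + h * v + h ^+ 2 * (al5 P * a + al6 P * ap))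
       (v + h * (al7 P * a + al8 P * ap))
       (al9 P * a + al10 P * ap).

(* The update without forcing is linear in X, and the columns of its matrix are
   the images of the basis vectors. *)
Definition Dnum (h : R) : 'M[R]_3 :=
  \matrix_(i, j) update h 0 (delta_mx j 0) i 0.

Definition Lnum (f : R -> R) (h t : R) : 'cV[R]_3 :=
  (f (t + pp P * h) / denom h) *:
    col3 (al6 P * h ^+ 2) (al8 P * h) (al10 P).

Lemma updateE (f : R -> R) (h t : R) (X : 'cV[R]_3) :
  update h (f (t + pp P * h)) X = Dnum h *m X + Lnum f h t.
Proof.
apply/matrixP => i j; rewrite !ord1 !mxE.
rewrite !big_ord_recr big_ord0 /= !mxE /acc_p !mxE /=.
set X0 := X 0 0; set X1 := X 1 0; set X2 := X 2%:R 0.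
have -> : X (widen_ord (leqnSn 2) (widen_ord (leqnSn 1) ord_max)) 0 = X0.
  by congr (X _ _); exact: val_inj.
have -> : X (widen_ord (leqnSn 2) ord_max) 0 = X1.
  by congr (X _ _); exact: val_inj.
have -> : X ord_max 0 = X2 by congr (X _ _); exact: val_inj.
by case: i => -[|[|[|]]] //= _; ring.
Qed.

Lemma scheme_stepE (f : R -> R) (h t u0 v0 a0 u1 v1 a1 : R) :
  denom h != 0 ->
  scheme_step (V := R^o) P id
    (fun u v s => f s - 2 * xi * om * v - om ^+ 2 * u) h t u0 v0 a0 u1 v1 a1
  <-> col3 u1 v1 a1 = Dnum h *m col3 u0 v0 a0 + Lnum f h t.
Proof.
move=> D0; rewrite -updateE.
set ap0 := acc_p h (f (t + pp P * h)) (col3 u0 v0 a0).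
have apE (ap : R) : ap = f (t + pp P * h)
    - 2 * xi * om * (v0 + h * (al3 P * a0 + al4 P * ap))
    - om ^+ 2 * (u0 + pp P * h * v0 + h ^+ 2 * (al1 P * a0 + al2 P * ap))
    <-> ap = ap0.
  have ap0E : ap0 * denom h =
      f (t + pp P * h) - 2 * xi * om * (v0 + al3 P * h * a0)
      - om ^+ 2 * (u0 + pp P * h * v0 + al1 P * h ^+ 2 * a0).
    by rewrite /ap0 /acc_p !mxE /= divfK.
  split=> [e|->].
  - apply: (mulIf D0); rewrite ap0E /denom.
    by rewrite !mulrDr mulr1 {1}e; ring.
  - have -> : ap0 = ap0 * denom h
        - (2 * al4 P * xi * om * h + al2 P * om ^+ 2 * h ^+ 2) * ap0.
      by rewrite /denom; ring.
    by rewrite [in LHS]ap0E /denom; ring.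
have updE : update h (f (t + pp P * h)) (col3 u0 v0 a0) =
    col3 (u0 + h * v0 + h ^+ 2 * (al5 P * a0 + al6 P * ap0))
         (v0 + h * (al7 P * a0 + al8 P * ap0)) (al9 P * a0 + al10 P * ap0).
  by rewrite /update -/ap0 !mxE.
rewrite updE; split.
- by case=> ap [/apE -> -> -> ->].
- move=> /colP e; exists ap0; split; first exact/apE.
  + by move: (e 0); rewrite !mxE.
  + by move: (e 1); rewrite !mxE.
  + by move: (e 2%:R); rewrite !mxE.
Qed.

End MatrixForm.

Definition smooth (R : realType) (f : R -> R) : Prop :=
  forall (n : nat) (x : R), derivable (derive1n n f) x 1.

Definition exact_solution (R : realType) (xi om : R) (f u : R -> R) : Prop :=
  forall x : R,
    [/\ derivable u x 1, derivable (derive1 u) x 1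
      & derive1n 2 u x + 2 * xi * om * derive1 u x + om ^+ 2 * u x = f x].

Definition state (R : realType) (u : R -> R) (t : R) : 'cV[R]_3 :=
  col3 (u t) (derive1 u t) (derive1n 2 u t).

Definition charcoef (R : realType) (P : scheme R) (xi om h : R) (i : nat) : R :=
  (char_poly (Dnum P xi om h))`_i.

(* The index i - 1 - j is nonnegative because j < i. *)
Definition trunc_err (R : realType) (P : scheme R) (xi om : R) (f u : R -> R)
    (t h : R) : 'cV[R]_3 :=
  (h ^+ 2)^-1 *:
    (\sum_(i < 4) charcoef P xi om h i *: state u (t + i%:R * h)
     - \sum_(i < 4) charcoef P xi om h i *:
         \sum_(j < i) (Dnum P xi om h ^+ j
                         *m Lnum P xi om f h (t + (i - 1 - j)%N%:R * h))).

(* Order of accuracy of component k: 0 is displacement, 1 velocity and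
   2 acceleration. Time steps are positive, so h tends to 0 from the right. *)
Definition order_accurate (R : realType) (P : scheme R) (xi om : R)
    (k : 'I_3) (r : nat) : Prop :=
  forall f u : R -> R, smooth f -> exact_solution xi om f u ->
  forall t : R,
    (fun h : R => trunc_err P xi om f u t h k 0) =O_ (0^'+) (fun h : R => h ^+ r).

Definition identical_order (R : realType) (P : scheme R) (xi om : R) (r : nat)
    : Prop :=
  forall k : 'I_3, order_accurate P xi om k r.

(* Main.v *)
Require Import Defs.
From mathcomp Require Import all_boot all_order all_algebra.
From mathcomp Require Import ring lra zify.
From mathcomp Require Import all_classical all_reals all_analysis.

(* Multiply the truncation error by [h ^+ 2], write E for the shift by h, and
   let kap = al7 al10 - al8 al9. Eliminating the states through adj (E - Dnum)
   turns the velocity and acceleration components into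
     charpoly(E) u'  - h (al8 E + kap) (E - 1) f(. + p h)  and
     charpoly(E) u'' - al10 (E - 1)^2 f(. + p h),
   where charpoly(E) = (E - al9) (E - 1)^2 + O(h). For a monomial u, only this
   undamped part of charpoly and the summand u'' of f reach the lowest power
   of h.
   - Acceleration, u = t^4, t^5, t^6: E - al9 and al10 exp(p z), where
     E = exp z, agree up to z^2. So al10 = 1 - al9, al10 p = 1 and
     al10 p^2 = 1, i.e. p = al10 = 1 and al9 = 0.
   - The velocity update is then v1 = v0 + h (al7 a0 + al8 a1). Velocity,
     u = t^3, t^4, t^5: this quadrature rule would have to integrate 1, t and
     t^2 exactly, but the first two force the trapezoidal rule, which does not
     integrate t^2. *)

Set Implicit Arguments.
Unset Strict Implicit.
Unset Printing Implicit Defensive.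

Import Order.TTheory GRing.Theory Num.Theory.
Import numFieldNormedType.Exports.
Local Open Scope classical_set_scope.
Local Open Scope ring_scope.

(** * Preliminaries on characteristic polynomials, limits and monomial motions *)

Lemma char_poly_mx33 (A : comNzRingType) (M : 'M[A]_3) :
  char_poly M = 'X^3
    - (M 0 0 + M 1 1 + M 2%:R 2%:R)%:P * 'X^2
    + (M 0 0 * M 1 1 - M 0 1 * M 1 0 + M 0 0 * M 2%:R 2%:R
       - M 0 2%:R * M 2%:R 0 + M 1 1 * M 2%:R 2%:R
       - M 1 2%:R * M 2%:R 1)%:P * 'X
    - (M 0 0 * (M 1 1 * M 2%:R 2%:R - M 1 2%:R * M 2%:R 1)
       - M 0 1 * (M 1 0 * M 2%:R 2%:R - M 1 2%:R * M 2%:R 0)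
       + M 0 2%:R * (M 1 0 * M 2%:R 1 - M 1 1 * M 2%:R 0))%:P.
Proof.
(* Indexing by naturals identifies the syntactically different ordinals that the cofactor expansion
   produces, so that [ring] sees equal entries. *)
pose m a b := M (inord a) (inord b).
have mE i j : M i j = m i j by rewrite /m !inord_val.
rewrite /char_poly (expand_det_row _ 0) !big_ord_recr big_ord0.
rewrite /cofactor !(expand_det_row _ 0) !big_ord_recr !big_ord0.
rewrite /cofactor !det_mx11 !mxE !mE /= /bump /= /modn /=.
by ring.
Qed.

(** For [0 < h <= 1] the bound gives [h ^+ k * |q.[h]| <= C * h ^+ (r + 2) <= h ^+ k * (C * h)],
    because [k < r + 2]. Cancelling [h ^+ k] and letting [h] tend to 0 leaves [|q.[0]| <= 0]. *)
Lemma leading_coef_eq0 (R : realType) (F : R -> R) (r k : nat) (q : {poly R}) :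
  (forall h, 0 < h -> F h = (h ^+ 2)^-1 * (h ^+ k * q.[h])) ->
  F =O_ (0^'+) (fun h => h ^+ r) -> (k < r + 2)%N -> q.[0] = 0.
Proof.
move=> FE /eqO_exP [C C0 CF] kr; apply/eqP; rewrite -normr_le0.
have H : (fun h : R => `|q.[h]|) @ 0^'+ --> `|q.[0]|.
  apply: cvg_norm; apply: cvg_at_right_filter; exact: continuous_horner.
have H2 : (fun h : R => C * h) @ 0^'+ --> C * 0.
  apply: cvgM; first exact: cvg_cst.
  by apply: cvg_at_right_filter; exact: cvg_id.
rewrite -[leRHS](mulr0 C).
apply: ler_cvg_to H H2 _.
near=> h.
have h0 : 0 < h by [].
have h1 : h <= 1 by near: h; exact: nbhs_right_le.
have : `|F h| <= C * `|h ^+ r| by near: h.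
rewrite FE // !normrM normfV !normrX !(gtr0_norm h0).
rewrite ler_pdivrMl ?exprn_gt0 // mulrCA -exprD => hq.
suff : h ^+ k * `|q.[h]| <= h ^+ k * (C * h) by rewrite ler_pM2l // exprn_gt0.
apply: le_trans hq _.
rewrite [leRHS]mulrCA ler_pM2l // -exprSr ler_wiXn2l //; last by rewrite addnC.
Unshelve. all: by end_near.
Qed.

Lemma derive1n_horner (R : realType) (q : {poly R}) n :
  derive1n n (horner q) = horner q^`(n).
Proof. by elim: n => // n IH; rewrite derive1nS IH -derivE -derivnS. Qed.

Lemma smooth_horner (R : realType) (q : {poly R}) : smooth (horner q).
Proof. by move=> n x; rewrite derive1n_horner; exact: derivable_horner. Qed.

Lemma state_horner (R : realType) m (x : R) :
  state (horner ('X^(m.+2) : {poly R})) x =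
  col3 (x ^+ m.+2) (m.+2%:R * x ^+ m.+1) (m.+2%:R * m.+1%:R * x ^+ m).
Proof.
rewrite /state derive1n_horner -derivE derivnS derivn1.
rewrite !derivXn derivMn derivXn /= !hornerMn !hornerXn -mulrnA.
by rewrite -![x ^+ _ *+ _]mulr_natl mulnC natrM.
Qed.

Lemma state_horner1 (R : realType) m (x : R) :
  state (horner ('X^(m.+2) : {poly R})) x 1 0 = m.+2%:R * x ^+ m.+1.
Proof. by rewrite state_horner mxE. Qed.

Lemma state_horner2 (R : realType) m (x : R) :
  state (horner ('X^(m.+2) : {poly R})) x 2%:R 0 = m.+2%:R * m.+1%:R * x ^+ m.
Proof. by rewrite state_horner mxE. Qed.

Lemma scale_col3 (R : realType) (a x y z : R) :
  a *: col3 x y z = col3 (a * x) (a * y) (a * z).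
Proof. by apply/colP => i; rewrite !mxE; case: i => -[|[|[|]]]. Qed.

(** * Matrix form and truncation error of a fully explicit scheme *)

Section ExplicitScheme.
Variables (R : realType) (P : scheme R) (xi om : R).
Hypothesis (P0 : fully_explicit P).

Lemma denom_explicit h : denom P xi om h = 1.
Proof. by case: P0 => a2 a4; rewrite /denom a2 a4; ring. Qed.

Lemma Dnum_mul_col3 (h x y z : R)
    (ap := - (2 * xi * om * (y + al3 P * h * z)
              + om ^+ 2 * (x + pp P * h * y + al1 P * h ^+ 2 * z))) :
  Dnum P xi om h *m col3 x y z =
    col3 (x + h * y + h ^+ 2 * (al5 P * z + al6 P * ap))
         (y + h * (al7 P * z + al8 P * ap)) (al9 P * z + al10 P * ap).
Proof.
have := updateE P xi om (fun=> 0) h 0 (col3 x y z).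
rewrite /Lnum mul0r scale0r addr0 => <-.
rewrite /update /acc_p denom_explicit !mxE /= divr1.
by rewrite /ap opprD sub0r.
Qed.

(** Here [kap] and [mu] are 2 by 2 minors of the update coefficients: the rows of the velocity and
    of the displacement, each paired with that of the acceleration. *)
Lemma charcoef_explicit (h : R) (c := 2 * xi * om * h) (w := om ^+ 2 * h ^+ 2)
    (kap := al7 P * al10 P - al8 P * al9 P)
    (mu := al5 P * al10 P - al6 P * al9 P) :
  [/\ charcoef P xi om h 3 = 1,
      charcoef P xi om h 2 = - (2 + al9 P) + c * (al8 P + al3 P * al10 P)
        + w * (al6 P + pp P * al8 P + al1 P * al10 P),
      charcoef P xi om h 1 = 1 + 2 * al9 P
        + c * (kap - al8 P - 2 * (al3 P * al10 P))
        + w * (mu - al6 P + al8 P + pp P * (kap - al8 P) - 2 * (al1 P * al10 P))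
    & charcoef P xi om h 0 = - al9 P + c * (al3 P * al10 P - kap)
        + w * (kap - mu - pp P * kap + al1 P * al10 P)].
Proof.
rewrite /charcoef char_poly_mx33.
rewrite !(coefB, coefD, coefCM, coefXn, coefX, coefC) /=.
rewrite !mxE /= /acc_p denom_explicit !mxE /=.
by rewrite /c /w /kap /mu; split; field.
Qed.

(* D + A2 and D^2 + A2 D + A1 are the lower coefficients of adj (E - D), as a
   polynomial in E. *)
Lemma forcing_resolvent (h : R)
    (A := charcoef P xi om h) (D := Dnum P xi om h)
    (l := col3 (al6 P * h ^+ 2) (al8 P * h) (al10 P)) (l' := D *m l)
    (kap := al7 P * al10 P - al8 P * al9 P) :
  [/\ l' 1 0 + A 2 * l 1 0 = h * (kap - al8 P),
      (D *m l') 1 0 + A 2 * l' 1 0 + A 1%N * l 1 0 = - (h * kap),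
      l' 2%:R 0 + A 2 * l 2%:R 0 = - (2 * al10 P)
    & (D *m l') 2%:R 0 + A 2 * l' 2%:R 0 + A 1%N * l 2%:R 0 = al10 P].
Proof.
have [_ A2 A1 _] := charcoef_explicit h.
rewrite /A A2 A1 /l' /l /D /kap !Dnum_mul_col3 !mxE /=.
by split; ring.
Qed.

(** Grouped by force samples, and with [A 3 = 1], the forcing sum has the coefficients [l] at [F 2],
    [D l + A2 l] at [F 1] and [D^2 l + A2 D l + A1 l] at [F 0]. The last two are evaluated by
    [forcing_resolvent]. *)
Lemma trunc_err_explicit (f u : R -> R) (t h : R)
    (A := charcoef P xi om h)
    (X := fun i : nat => state u (t + i%:R * h))
    (F := fun i : nat => f (t + i%:R * h + pp P * h)) :
  trunc_err P xi om f u t h 1 0 = (h ^+ 2)^-1 *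
    (\sum_(i < 4) A i * X i 1 0
     - h * (al8 P * (F 2%N - F 1%N) +
          (al7 P * al10 P - al8 P * al9 P) * (F 1%N - F 0%N))) /\
  trunc_err P xi om f u t h 2%:R 0 = (h ^+ 2)^-1 *
    (\sum_(i < 4) A i * X i 2%:R 0
     - al10 P * (F 2%N - 2 * F 1%N + F 0%N)).
Proof.
have [] := forcing_resolvent h.
have := erefl (A 3); rewrite {2}/A; have [-> _ _ _] := charcoef_explicit h.
rewrite /trunc_err -/A.
set D := Dnum P xi om h; set l := col3 (al6 P * h ^+ 2) (al8 P * h) (al10 P).
have LE i : Lnum P xi om f h (t + i%:R * h) = F i *: l.
  by rewrite /Lnum denom_explicit divr1.
have DE a : D ^+ 1 *m (a *: l) = a *: (D *m l) by rewrite expr1 scalemxAr.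
have DDE a : D ^+ 2 *m (a *: l) = a *: (D *m (D *m l)).
  by rewrite expr2 -mulmxE -mulmxA !scalemxAr.
rewrite !big_ord_recr !big_ord0 /= !LE DDE !DE !expr0 !mul1mx.
rewrite -!/(X _) !subn0 /=.
have l1 : l 1 0 = al8 P * h by rewrite mxE.
have l2 : l 2%:R 0 = al10 P by rewrite mxE.
clear LE DE DDE; clearbody X F l.
move: (D *m l) => l'; move: (D *m l') => l'' A3.
(* Each resolvent identity is solved for its term with the highest power of [D], ready for
   substitution. *)
rewrite l1 l2 => /(canRL (addrK _)) E1 /(canRL (addrK _)) /(canRL (addrK _)) E2.
move=> /(canRL (addrK _)) E3 /(canRL (addrK _)) /(canRL (addrK _)) E4.
clearbody A.
rewrite A3; split; rewrite mxE; congr (_ * _).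
  rewrite !mxE !l1 E2 E1; ring.
rewrite !mxE !l2 E4 E3; ring.
Qed.

(** The constant terms are the coefficients of [(E - al9) (E - 1)^2], the undamped part. *)
Lemma charcoef_poly :
  exists2 A : nat -> {poly R},
    forall h i, (i < 4)%N -> charcoef P xi om h i = (A i).[h]
  & [/\ (A 0%N).[0] = - al9 P, (A 1%N).[0] = 1 + 2 * al9 P,
        (A 2).[0] = - (2 + al9 P) & (A 3).[0] = 1].
Proof.
pose kap := al7 P * al10 P - al8 P * al9 P.
pose mu := al5 P * al10 P - al6 P * al9 P.
pose quad a b c := a%:P + (2 * xi * om * b)%:P * 'X + (om ^+ 2 * c)%:P * 'X^2.
exists (fun i => nth 0 [::
  quad (- al9 P) (al3 P * al10 P - kap)
    (kap - mu - pp P * kap + al1 P * al10 P);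
  quad (1 + 2 * al9 P) (kap - al8 P - 2 * (al3 P * al10 P))
    (mu - al6 P + al8 P + pp P * (kap - al8 P) - 2 * (al1 P * al10 P));
  quad (- (2 + al9 P)) (al8 P + al3 P * al10 P)
    (al6 P + pp P * al8 P + al1 P * al10 P); 1] i).
- move=> h i; have [e3 e2 e1 e0] := charcoef_explicit h.
  case: i => [|[|[|[|]]]] //= _; rewrite ?e3 ?e2 ?e1 ?e0 /quad !hornerE //=;
    rewrite /kap /mu; ring.
- by split; rewrite /= /quad !hornerE //= ?expr0n /=; ring.
Qed.

(** * Monomial exact solutions and the order conditions that they impose *)

Definition forcing_poly m : {poly R} :=
  ('X^(m.+2))^`(2) + (2 * xi * om) *: ('X^(m.+2))^`() + (om ^+ 2) *: 'X^(m.+2).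

Lemma horner_exact_solution m :
  exact_solution xi om (horner (forcing_poly m)) (horner 'X^(m.+2)).
Proof.
move=> x; rewrite derive1n_horner -derivE; split; try exact: derivable_horner.
by rewrite /forcing_poly !hornerE.
Qed.

Lemma horner_forcing_poly m x :
  (forcing_poly m).[x] = m.+2%:R * m.+1%:R * x ^+ m
    + 2 * xi * om * (m.+2%:R * x ^+ m.+1) + om ^+ 2 * x ^+ m.+2.
Proof.
have [_ _ <-] := horner_exact_solution m x.
have := state_horner m x => /colP e.
move: (e 0) (e 1) (e 2%:R); rewrite !mxE /= => -> -> ->.
by ring.
Qed.

Variables (r : nat) (r3 : (3 <= r)%N).

(** [lead n] is [(E - al9) (E - 1)^2], with unit shift [E], applied to [s^n] at [s = 0]. For
    [u = t^(m+2)] started at time 0, a power of [h] factors out of the error and leaves a polynomial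
    [q] in [h]; the condition is [q.[0] = 0]. The bounds on [m] are what [3 <= r] allows in
    [leading_coef_eq0]. *)
Lemma order_conditions (kap := al7 P * al10 P - al8 P * al9 P)
    (lead := fun n : nat =>
       3 ^+ n - (2 + al9 P) * 2 ^+ n + (1 + 2 * al9 P) - al9 P * 0 ^+ n) m :
  (order_accurate P xi om 1 r -> (m <= 3)%N ->
    lead m.+1 = m.+1%:R * (al8 P * ((2 + pp P) ^+ m - (1 + pp P) ^+ m)
      + kap * ((1 + pp P) ^+ m - pp P ^+ m))) /\
  (order_accurate P xi om 2%:R r -> (m <= 4)%N ->
    lead m = al10 P * ((2 + pp P) ^+ m - 2 * (1 + pp P) ^+ m + pp P ^+ m)).
Proof.
have [A AE [A0 A1 A2 A3]] := charcoef_poly.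
(* [G j] is the force at time [(j + p) h] with [h ^+ m] divided out; its constant term comes from
   [u''] alone. *)
pose G (j : nat) := (m.+2%:R * m.+1%:R * (j%:R + pp P) ^+ m)%:P
  + (2 * xi * om * m.+2%:R * (j%:R + pp P) ^+ m.+1)%:P * 'X
  + (om ^+ 2 * (j%:R + pp P) ^+ m.+2)%:P * 'X^2 : {poly R}.
have fE (h : R) j :
    (forcing_poly m).[0 + j%:R * h + pp P * h] = h ^+ m * (G j).[h].
  rewrite horner_forcing_poly add0r -mulrDl.
  rewrite /G !(hornerD, hornerM, hornerC, hornerXn, hornerX).
  rewrite !(exprMn _ (j%:R + pp P)) (exprS h m.+1) (exprS h m).
  ring.
have G0E j : (G j).[0] = m.+2%:R * m.+1%:R * (j%:R + pp P) ^+ m.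
  rewrite /G !(hornerD, hornerM, hornerC, hornerXn, hornerX).
  by rewrite !(mulr0, mul0r) !addr0.
clearbody G.
have K0 : (m.+2%:R : R) != 0 by rewrite pnatr_eq0.
have K1 : (m.+1%:R : R) != 0 by rewrite pnatr_eq0.
split=> ord lem.
- pose q : {poly R} := \sum_(i < 4) A i * (m.+2%:R * i%:R ^+ m.+1)%:P
    - ((al8 P)%:P * (G 2%N - G 1%N) + kap%:P * (G 1%N - G 0%N)).
  have qE h : 0 < h ->
      trunc_err P xi om (horner (forcing_poly m)) (horner 'X^(m.+2)) 0 h 1 0 =
      (h ^+ 2)^-1 * (h ^+ m.+1 * q.[h]).
    move=> h0.
    have [-> _] :=
      trunc_err_explicit (horner (forcing_poly m)) (horner 'X^(m.+2)) 0 h.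
    rewrite !fE /q hornerD hornerN horner_sum; congr (_ * _).
    rewrite [RHS]mulrBr big_distrr /=.
    congr (_ - _).
      apply: eq_bigr => i _.
      by rewrite AE // state_horner1 add0r exprMn hornerM hornerC; ring.
    rewrite !(hornerD, hornerM, hornerN, hornerMn, hornerC) (exprS h) -/kap.
    move: (G 0%N).[h] (G 1%N).[h] (G 2%N).[h] (h ^+ m) => g0 g1 g2 hm.
    by ring.
  have lt : (m.+1 < r + 2)%N by lia.
  have NO := ord _ _ (@smooth_horner _ _) (horner_exact_solution m) 0.
  have := leading_coef_eq0 qE NO lt.
  rewrite /q !big_ord_recr !big_ord0 /= !(hornerD, hornerN, hornerM, hornerC).
  rewrite A0 A1 A2 A3 !G0E expr1n !add0r => q0.
  apply: (mulfI K0); apply: subr0_eq.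
  by rewrite -[RHS]q0 /lead; ring.
- pose q : {poly R} := \sum_(i < 4) A i * (m.+2%:R * m.+1%:R * i%:R ^+ m)%:P
    - (al10 P)%:P * (G 2%N - G 1%N *+ 2 + G 0%N).
  have qE h : 0 < h ->
      trunc_err P xi om (horner (forcing_poly m)) (horner 'X^(m.+2)) 0 h 2%:R 0 =
      (h ^+ 2)^-1 * (h ^+ m * q.[h]).
    move=> h0.
    have [_ ->] :=
      trunc_err_explicit (horner (forcing_poly m)) (horner 'X^(m.+2)) 0 h.
    rewrite !fE /q hornerD hornerN horner_sum; congr (_ * _).
    rewrite [RHS]mulrBr big_distrr /=.
    congr (_ - _).
      apply: eq_bigr => i _.
      by rewrite AE // state_horner2 add0r exprMn hornerM hornerC; ring.
    rewrite !(hornerD, hornerM, hornerN, hornerMn, hornerC).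
    move: (G 0%N).[h] (G 1%N).[h] (G 2%N).[h] (h ^+ m) => g0 g1 g2 hm.
    by ring.
  have lt : (m < r + 2)%N by lia.
  have NO := ord _ _ (@smooth_horner _ _) (horner_exact_solution m) 0.
  have := leading_coef_eq0 qE NO lt.
  rewrite /q !big_ord_recr !big_ord0 /=.
  rewrite !(hornerD, hornerN, hornerM, hornerMn, hornerC).
  rewrite A0 A1 A2 A3 !G0E expr1n !add0r => q0.
  apply: (mulfI (mulf_neq0 K0 K1)); apply: subr0_eq.
  by rewrite -[RHS]q0 /lead; ring.
Qed.

End ExplicitScheme.

Theorem theorem3p1 (R : realType) (xi om : R)
    (xi_gt0 : 0 < xi) (xi_lt1 : xi < 1) (om_gt0 : 0 < om) :
  ~ exists (P : scheme R) (r : nat),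
      [/\ fully_explicit P, (3 <= r)%N & identical_order P xi om r].
Proof.
move=> [P [r [P0 r3 ord]]].
have ha m : (m <= 4)%N -> _ :=
  proj2 (@order_conditions R P xi om P0 r r3 m) (ord 2%:R).
have hv m : (m <= 3)%N -> _ :=
  proj1 (@order_conditions R P xi om P0 r r3 m) (ord 1).
have := ha 2%N isT; have := ha 3%N isT; have := ha 4%N isT.
have := hv 1%N isT; have := hv 2%N isT; have := hv 3%N isT.
rewrite /=; set p := pp P; set a7 := al7 P; set a8 := al8 P.
set a9 := al9 P; set a10 := al10 P.
(* The velocity conditions are numbered by the degree of [u], the acceleration conditions by that of
   [u'']. *)
rewrite !(expr0n, expr1n) /= => v5 v4 v3 a4 a3 a2.
have e1 : a10 = 1 - a9 by lra.
have e2 : a10 * p = 1 by nra.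
have e3 : a10 * p ^+ 2 = 1 by nra.
have p1 : p = 1 by rewrite -[RHS]e3 expr2 mulrA e2 mul1r.
have a10_1 : a10 = 1 by rewrite -e2 p1 mulr1.
have a9_0 : a9 = 0 by lra.
(* Now [kap] equals [a7]: [v3] and [v4] force [a7 = a8 = 1/2], and then [v5] reads [50 = 52]. *)
move: v5 v4 v3; rewrite p1 a10_1 a9_0; lra.
Qed.
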